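(* The following identities hold in $\mathcal U([\hat{\mathfrak g},\hat{\mathfrak g}])$. (1) Let $\beta\in\dot\triangle^+$, $p\in\mathbb{N}^{\mathbb{Z}}_{\mathbf f}$ and $r\in\mathbb{Z}$ with $r\notin-\mathrm{supp}(p)$. Then $$X_\beta(r)Y_\beta^p=Y_\beta^pX_\beta(r)+\sum_{s\in\mathrm{supp}(p)}\frac{\partial Y_\beta^p}{\partial Y_\beta(s)}h_\beta(r+s)-\frac{\beta(h_\beta)}{2}\sum_{s_1,s_2\in\mathrm{supp}(p)}\frac{\partial^2Y_\beta^p}{\partial Y_\beta(s_1)\partial Y_\beta(s_2)}Y_\beta(s_1+s_2+r).$$ (2) Let $1\le i\le m$, $p_i,\dots,p_m\in\mathbb{N}^{\mathbb{Z}}_{\mathbf f}$ and $r\in\mathbb{Z}$ with $r\notin\bigcup_{j=i}^m-\mathrm{supp}(p_j)$. Then $$\begin{aligned}X_{\beta_i}(r)Y_{\beta_i}^{p_i}\cdots Y_{\beta_m}^{p_m}={}&Y_{\beta_i}^{p_i}Y_{\beta_{i+1}}^{p_{i+1}}\cdots Y_{\beta_m}^{p_m}X_{\beta_i}(r)+Y_{\beta_i}^{p_i}\big[X_{\beta_i}(r),Y_{\beta_{i+1}}^{p_{i+1}}\cdots Y_{\beta_m}^{p_m}\big]\\&+\sum_{s\in\mathrm{supp}(p_i)}\frac{\partial Y_{\beta_i}^{p_i}}{\partial Y_{\beta_i}(s)}Y_{\beta_{i+1}}^{p_{i+1}}\cdots Y_{\beta_m}^{p_m}h_{\beta_i}(r+s)\\&-\frac{\beta_i(h_{\beta_i})}{2}\sum_{s_1,s_2\in\mathrm{supp}(p_i)}\frac{\partial^2Y_{\beta_i}^{p_i}}{\partial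 Y_{\beta_i}(s_1)\partial Y_{\beta_i}(s_2)}Y_{\beta_i}(s_1+s_2+r)Y_{\beta_{i+1}}^{p_{i+1}}\cdots Y_{\beta_m}^{p_m}\\&-\sum_{s\in\mathrm{supp}(p_i)}\sum_{t=i+1}^m\frac{\partial Y_{\beta_i}^{p_i}}{\partial Y_{\beta_i}(s)}(Y_{\beta_{i+1}}^{p_{i+1}})^*_t\cdots(Y_{\beta_m}^{p_m})^*_t,\end{aligned}$$ where, for $1\le l\le m-i$, $(Y_{\beta_{i+l}}^{p_{i+l}})^*_t=Y_{\beta_{i+l}}^{p_{i+l}}$ if $t\neq i+l$, and $$(Y_{\beta_{i+l}}^{p_{i+l}})^*_t=\beta_{i+l}(h_{\beta_i})\sum_{s_1\in\mathrm{supp}(p_{i+l})}\frac{\partial Y_{\beta_{i+l}}^{p_{i+l}}}{\partial Y_{\beta_{i+l}}(s_1)}Y_{\beta_{i+l}}(r+s+s_1)\quad\text{if }t=i+l.$$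
   Context: Let $\mathfrak g$ be a finite-dimensional complex simple Lie algebra with Cartan subalgebra $\dot{\mathfrak h}$ and simple roots $\alpha_1,\dots,\alpha_n$; $\dot\triangle^+$ is the set of positive roots. The affine Lie algebra is $\hat{\mathfrak g}=\mathfrak g\otimes\mathbb{C}[t^{\pm1}]\oplus\mathbb{C}c\oplus\mathbb{C}d$, with $c$ central, $[d,x\otimes t^k]=k\,x\otimes t^k$, $[x\otimes t^k,y\otimes t^l]=[x,y]\otimes t^{k+l}+\delta_{k+l,0}k(x|y)c$, and $[\hat{\mathfrak g},\hat{\mathfrak g}]=\mathfrak g\otimes\mathbb{C}[t^{\pm1}]\oplus\mathbb{C}c$. Write $x(r)=x\otimes t^r$. Order the simple roots by $\alpha_1<\cdots<\alpha_n$ and extend lexicographically to the positive root monoid; this induces a total order $\beta_1<\beta_2<\cdots<\beta_m$ on $\dot\triangle^+$. For $\beta\in\dot\triangle^+$, $X_\beta\in\mathfrak g_\beta$ and $Y_\beta\in\mathfrak g_{-\beta}$ are root vectors with $h_\beta=[X_\beta,Y_\beta]$ such that $\{X_\beta,Y_\beta,h_\beta\}$ is an $\mathfrak{sl}_2$-triple. $\mathbb{N}^{\mathbb{Z}}_{\mathbf f}$ is the set of finitely supported functions $\mathbb{Z}\to\mathbb{N}$ ($\mathbb{N}$ includes $0$); $\mathrm{supp}(p)=\{s:p(s)\ne0\}$ and $-\mathrm{supp}(p)=\{-s:s\in\mathrm{supp}(p)\}$. For $p\in\mathbb{N}^{\mathbb{Z}}_{\mathbf f}$, $Y_\beta^p=\prod_{r\in\mathbb{Z}}Y_\beta(r)^{p(r)}$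 (the factors commute). Partial derivatives $\partial/\partial Y_\beta(s)$ are formal partial derivatives of monomials in the commuting variables $Y_\beta(s)$. *)

(* Defs.v *)
From HB Require Import structures.
From mathcomp Require Import all_boot all_order all_algebra finmap generic_quotient.
From mathcomp Require Import boolp.
From mathcomp Require Export reals complex.

Set Implicit Arguments.
Unset Strict Implicit.
Unset Printing Implicit Defensive.

Import GRing.Theory Num.Theory.
Local Open Scope quotient_scope.
Local Open Scope fset_scope.
Local Open Scope ring_scope.

HB.mixin Record Lmodule_isLie (K : fieldType) L of GRing.Lmodule K L := {
  lie : L -> L -> L;
  lie_linear : forall x, linear (lie x);
  lie_linearl : forall y, linear (lie^~ y);
  liexx : forall x, lie x x = 0;
  lie_jacobi : forall x y z,
    lie x (lie y z) + lie y (lie z x) + lie z (lie x y) = 0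
}.

#[short(type="lieType")]
HB.structure Definition Lie (K : fieldType) :=
  {L of GRing.Lmodule K L & Lmodule_isLie K L}.

#[short(type="finLieType")]
HB.structure Definition FinLie (K : fieldType) :=
  {L of Vector K L & Lmodule_isLie K L}.

Notation "[[ x , y ]]" := (lie x y) (at level 0, format "[[ x ,  y ]]").

Section LieTheory.
Variables (K : fieldType) (L : lieType K).
Implicit Types x y z : L.

Lemma lieDr x y z : [[x, y + z]] = [[x, y]] + [[x, z]].
Proof. by have := lie_linear x 1 y z; rewrite !scale1r. Qed.

Lemma lieDl x y z : [[x + y, z]] = [[x, z]] + [[y, z]].
Proof. by have := lie_linearl z 1 x y; rewrite !scale1r. Qed.

Lemma lie0r x : [[x, 0]] = 0.
Proof. by apply: (addrI [[x, 0]]); rewrite -lieDr !addr0. Qed.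

Lemma lie0l x : [[0, x]] = 0.
Proof. by apply: (addrI [[0, x]]); rewrite -lieDl !addr0. Qed.

Lemma lieZr a x y : [[x, a *: y]] = a *: [[x, y]].
Proof. by have := lie_linear x a y 0; rewrite !addr0 lie0r addr0. Qed.

Lemma lieZl a x y : [[a *: x, y]] = a *: [[x, y]].
Proof. by have := lie_linearl y a x 0; rewrite !addr0 lie0l addr0. Qed.

Lemma lieC x y : [[x, y]] = - [[y, x]].
Proof.
apply/eqP; rewrite -subr_eq0 opprK; apply/eqP.
by have := liexx (x + y); rewrite lieDl !lieDr !liexx add0r addr0.
Qed.

End LieTheory.

(* The unital associative algebra generated by the elements of [L], subject
   to linearity and to [x * y - y * x = [[x, y]]]: formal expressions modulo
   the congruence generated by these relations and the algebra axioms. *)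
Inductive uterm (K L : Type) : Type :=
| UConst of K
| UGen of L
| UAdd of uterm K L & uterm K L
| UMul of uterm K L & uterm K L.
Arguments UConst {K L}.
Arguments UGen {K L}.

HB.instance Definition _ (K L : Type) := gen_eqMixin (uterm K L).
HB.instance Definition _ (K L : Type) := gen_choiceMixin (uterm K L).

Section Enveloping.
Variables (K : fieldType) (L : lieType K).
Local Notation T := (uterm K L).

Inductive ueq : T -> T -> Prop :=
| ueq_refl a : ueq a a
| ueq_sym a b : ueq a b -> ueq b a
| ueq_trans a b c : ueq a b -> ueq b c -> ueq a c
| ueq_add a a' b b' : ueq a a' -> ueq b b' -> ueq (UAdd a b) (UAdd a' b')
| ueq_mul a a' b b' : ueq a a' -> ueq b b' -> ueq (UMul a b) (UMul a' b')
| ueq_addA a b c : ueq (UAdd a (UAdd b c)) (UAdd (UAdd a b) c)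
| ueq_addC a b : ueq (UAdd a b) (UAdd b a)
| ueq_add0 a : ueq (UAdd (UConst 0) a) a
| ueq_addN a : ueq (UAdd (UMul (UConst (-1)) a) a) (UConst 0)
| ueq_mulA a b c : ueq (UMul a (UMul b c)) (UMul (UMul a b) c)
| ueq_mul1 a : ueq (UMul (UConst 1) a) a
| ueq_mulDl a b c : ueq (UMul (UAdd a b) c) (UAdd (UMul a c) (UMul b c))
| ueq_mulDr a b c : ueq (UMul a (UAdd b c)) (UAdd (UMul a b) (UMul a c))
| ueq_constD s t : ueq (UConst (s + t)) (UAdd (UConst s) (UConst t))
| ueq_constM s t : ueq (UConst (s * t)) (UMul (UConst s) (UConst t))
| ueq_constC s a : ueq (UMul (UConst s) a) (UMul a (UConst s))
| ueq_genP s x y :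
    ueq (UGen (s *: x + y)) (UAdd (UMul (UConst s) (UGen x)) (UGen y))
| ueq_lie x y :
    ueq (UMul (UGen x) (UGen y)) (UAdd (UMul (UGen y) (UGen x)) (UGen [[x, y]])).

Definition ueqb (a b : T) : bool := `[< ueq a b >].

Lemma ueqb_equiv : equiv_class_of ueqb.
Proof.
split=> [a | a b | b a c].
- exact/asboolP/ueq_refl.
- by apply/asboolP/asboolP; apply: ueq_sym.
- by move=> /asboolP ab /asboolP bc; apply/asboolP; apply: ueq_trans bc.
Qed.

Canonical ueq_equiv := EquivRelPack ueqb_equiv.

Definition uenv : Type := {eq_quot ueq_equiv}.
HB.instance Definition _ := Choice.on uenv.
HB.instance Definition _ := EqQuotient.on uenv.

Definition upi (a : T) : uenv := \pi_uenv a.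

Lemma upiP a b : upi a = upi b <-> ueq a b.
Proof.
split; first by move=> /eqP; rewrite /upi eqmodE => /asboolP.
by move=> ab; apply/eqP; rewrite /upi eqmodE; apply/asboolP.
Qed.

Lemma upi_eq a b : ueq a b -> upi a = upi b. Proof. by move/upiP. Qed.

Lemma upiK u : upi (repr u) = u. Proof. exact: reprK. Qed.

Definition uadd (u v : uenv) := upi (UAdd (repr u) (repr v)).
Definition umul (u v : uenv) := upi (UMul (repr u) (repr v)).
Definition uconst (s : K) := upi (UConst s).
Definition uopp (u : uenv) := umul (uconst (-1)) u.

Lemma upi_add a b : upi (UAdd a b) = uadd (upi a) (upi b).
Proof. by apply/upiP; apply: ueq_add; apply/upiP; rewrite upiK. Qed.

Lemma upi_mul a b : upi (UMul a b) = umul (upi a) (upi b).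
Proof. by apply/upiP; apply: ueq_mul; apply/upiP; rewrite upiK. Qed.

Let E := (=^~ upi_add, =^~ upi_mul).
Ltac ulift lem :=
  repeat (let u := fresh "u" in move=> u; try rewrite -(upiK u));
  rewrite /uopp /uconst ?E; apply/upiP; apply: lem.

Lemma uaddA : associative uadd. Proof. ulift ueq_addA. Qed.
Lemma uaddC : commutative uadd. Proof. ulift ueq_addC. Qed.
Lemma uadd0 : left_id (uconst 0) uadd. Proof. ulift ueq_add0. Qed.
Lemma uaddN : left_inverse (uconst 0) uopp uadd. Proof. ulift ueq_addN. Qed.
Lemma umulA : associative umul. Proof. ulift ueq_mulA. Qed.
Lemma umul1 : left_id (uconst 1) umul. Proof. ulift ueq_mul1. Qed.
Lemma uconstC s u : umul (uconst s) u = umul u (uconst s).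
Proof. by move: s u; ulift ueq_constC. Qed.
Lemma umulr1 : right_id (uconst 1) umul.
Proof. by move=> u; rewrite -uconstC umul1. Qed.
Lemma umulDl : left_distributive umul uadd. Proof. ulift ueq_mulDl. Qed.
Lemma umulDr : right_distributive umul uadd. Proof. ulift ueq_mulDr. Qed.

(* The quotient map [uenv -> K] killing [L], which shows [1 != 0]. *)
Fixpoint uaug (a : T) : K :=
  match a with
  | UConst s => s
  | UGen _ => 0
  | UAdd a b => uaug a + uaug b
  | UMul a b => uaug a * uaug b
  end.

Lemma uaug_eq a b : ueq a b -> uaug a = uaug b.
Proof.
elim=> //=.
- by move=> {}a {}b c _ -> _ ->.
- by move=> {}a a' {}b b' _ -> _ ->.
- by move=> {}a a' {}b b' _ -> _ ->.
- by move=> *; rewrite addrA.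
- by move=> *; rewrite addrC.
- by move=> *; rewrite add0r.
- by move=> *; rewrite mulN1r addNr.
- by move=> *; rewrite mulrA.
- by move=> *; rewrite mul1r.
- by move=> *; rewrite mulrDl.
- by move=> *; rewrite mulrDr.
- by move=> *; rewrite mulrC.
- by move=> *; rewrite mulr0 addr0.
- by move=> *; rewrite mulr0 addr0.
Qed.

Lemma uconst10 : uconst 1 != uconst 0.
Proof. by apply/eqP => /upiP/uaug_eq /= /eqP; rewrite oner_eq0. Qed.

HB.instance Definition _ := GRing.isZmodule.Build uenv uaddA uaddC uadd0 uaddN.
HB.instance Definition _ := GRing.Zmodule_isNzRing.Build uenv
  umulA umul1 umulr1 umulDl umulDr uconst10.

Definition uscale (s : K) (u : uenv) : uenv := uconst s * u.

Lemma uconstD s t : uconst (s + t) = uconst s + uconst t.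
Proof. by rewrite /uconst [RHS]E; apply/upiP/ueq_constD. Qed.

Lemma uconstM s t : uconst (s * t) = uconst s * uconst t.
Proof. by rewrite /uconst [RHS]E; apply/upiP/ueq_constM. Qed.

Lemma uscaleA s t u : uscale s (uscale t u) = uscale (s * t) u.
Proof. by rewrite /uscale uconstM mulrA. Qed.
Lemma uscale1 : left_id 1 uscale. Proof. by move=> u; exact: mul1r. Qed.
Lemma uscaleDr : right_distributive uscale +%R.
Proof. by move=> s u v; exact: mulrDr. Qed.
Lemma uscaleDl u : {morph uscale^~ u : s t / s + t}.
Proof. by move=> s t; rewrite /uscale uconstD mulrDl. Qed.

HB.instance Definition _ := GRing.Zmodule_isLmodule.Build K uenv
  uscaleA uscale1 uscaleDr uscaleDl.

Lemma uscaleAl s (u v : uenv) : s *: (u * v) = (s *: u) * v.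
Proof. exact: mulrA. Qed.
Lemma uscaleAr s (u v : uenv) : s *: (u * v) = u * (s *: v).
Proof.
have sE (w : uenv) : s *: w = uconst s * w by [].
by rewrite !sE !mulrA; congr (_ * _); exact: uconstC.
Qed.

HB.instance Definition _ := GRing.Lmodule_isLalgebra.Build K uenv uscaleAl.
HB.instance Definition _ := GRing.Lalgebra_isAlgebra.Build K uenv uscaleAr.

Definition ugen (x : L) : uenv := upi (UGen x).

Lemma ugen_linear : linear ugen.
Proof.
move=> s x y; by rewrite /ugen (upi_eq (ueq_genP s x y)) upi_add upi_mul.
Qed.

HB.instance Definition _ := GRing.isLinear.Build K L uenv _ ugen ugen_linear.

Lemma ugen_lie x y : ugen x * ugen y - ugen y * ugen x = ugen [[x, y]].
Proof.
apply/eqP; rewrite subr_eq addrC; apply/eqP.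
have -> : ugen x * ugen y = upi (UMul (UGen x) (UGen y)) by rewrite upi_mul.
by rewrite (upi_eq (ueq_lie x y)) upi_add upi_mul.
Qed.

Section Lift.
Variables (A : algType K) (f : {linear L -> A}).
Hypothesis f_lie : forall x y, f [[x, y]] = f x * f y - f y * f x.

Fixpoint ulift_term (a : T) : A :=
  match a with
  | UConst s => s%:A
  | UGen x => f x
  | UAdd a b => ulift_term a + ulift_term b
  | UMul a b => ulift_term a * ulift_term b
  end.

Lemma ulift_eq a b : ueq a b -> ulift_term a = ulift_term b.
Proof.
elim=> //=.
- by move=> {}a {}b c _ -> _ ->.
- by move=> {}a a' {}b b' _ -> _ ->.
- by move=> {}a a' {}b b' _ -> _ ->.
- by move=> *; rewrite addrA.
- by move=> *; rewrite addrC.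
- by move=> *; rewrite scale0r add0r.
- by move=> *; rewrite scaleN1r mulN1r addNr scale0r.
- by move=> *; rewrite mulrA.
- by move=> *; rewrite scale1r mul1r.
- by move=> *; rewrite mulrDl.
- by move=> *; rewrite mulrDr.
- by move=> *; rewrite scalerDl.
- by move=> *; rewrite -scalerAl mul1r scalerA.
- by move=> *; rewrite -scalerAl -scalerAr mul1r mulr1.
- by move=> *; rewrite linearP -scalerAl mul1r.
- by move=> x y; rewrite f_lie addrC subrK.
Qed.

Theorem uenv_universal :
  exists F : {lrmorphism uenv -> A}, (forall x, F (ugen x) = f x) /\
    forall G : {lrmorphism uenv -> A}, (forall x, G (ugen x) = f x) -> G =1 F.
Proof.
pose F (u : uenv) := ulift_term (repr u).
have FE a : F (upi a) = ulift_term a.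
  by apply: ulift_eq; apply/upiP; rewrite upiK.
have FM : monoid_morphism F.
  split; first by rewrite [LHS]FE /= scale1r.
  by move=> u v; rewrite [LHS]FE.
have FL : linear F.
  move=> s u v; rewrite -[u]upiK -[v]upiK.
  have -> : s *: upi (repr u) + upi (repr v)
    = upi (UAdd (UMul (UConst s) (repr u)) (repr v)) by rewrite upi_add upi_mul.
  by rewrite !FE /= -scalerAl mul1r.
pose FlB := GRing.isLinear.Build K uenv A _ F FL.
pose FmB := GRing.isMonoidMorphism.Build uenv A F FM.
pose F' : {lrmorphism uenv -> A} := HB.pack F FlB FmB.
exists F'; split=> [x | G GE u]; first exact: FE.
rewrite -[u]upiK [RHS]FE; elim: (repr u) => [s | x | a IHa b IHb | a IHa b IHb] /=.
- have -> : upi (UConst s) = s%:A by rewrite -[LHS]mulr1.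
  by rewrite linearZ /= rmorph1.
- exact: GE.
- by rewrite upi_add -IHa -IHb; exact: (rmorphD G).
- by rewrite upi_mul -IHa -IHb; exact: (rmorphM G).
Qed.

End Lift.
End Enveloping.

Section Structure.
Variables (K : fieldType) (g : finLieType K).
Implicit Types U V H : {vspace g}.

Definition lie_ideal U := forall x y : g, y \in U -> [[x, y]] \in U.

Definition simple_lie : Prop :=
  (exists x y : g, [[x, y]] != 0) /\
  forall U, lie_ideal U -> U = 0%VS \/ U = fullv.

Definition lie_subalgebra U :=
  forall x y : g, x \in U -> y \in U -> [[x, y]] \in U.

Definition lie_prod U V : {vspace g} :=
  <<[seq [[x, y]] | x <- vbasis U, y <- vbasis V]>>%VS.

Definition nilpotent_lie U : Prop := exists k, iter k (lie_prod U) U = 0%VS.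

Definition cartan_subalgebra H : Prop :=
  [/\ lie_subalgebra H, nilpotent_lie H &
      forall x, (forall y, y \in H -> [[x, y]] \in H) -> x \in H].

Definition hdual H := 'Hom(subvs_of H, K^o).

(* The value of a weight at an element of [g], meant for elements of [H]. *)
Definition weval H (a : hdual H) (x : g) : K := a (vsproj H x).

Definition in_root_space H (a : hdual H) (x : g) : Prop :=
  forall h, h \in H -> [[h, x]] = weval a h *: x.

Definition is_root H (a : hdual H) : Prop :=
  a != 0 /\ exists2 x, x != 0 & in_root_space a x.

Section Base.
Variables (H : {vspace g}) (n : nat) (alpha : n.-tuple (hdual H)).

Definition nat_comb (k : 'I_n -> nat) : hdual H :=
  \sum_(i < n) tnth alpha i *+ k i.

Definition simple_system : Prop :=
  [/\ basis_of fullv alpha, forall i, is_root (tnth alpha i) &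
      forall b : hdual H, is_root b ->
        exists k, b = nat_comb k \/ b = - nat_comb k].

Definition positive_root (b : hdual H) : Prop :=
  is_root b /\ exists k, b = nat_comb k.

(* The lexicographic order on the positive root monoid in which
   [alpha_1 < ... < alpha_n]: the last simple root is the most significant. *)
Definition lex_lt (a b : hdual H) : Prop :=
  exists k l : 'I_n -> nat, [/\ a = nat_comb k, b = nat_comb l &
    exists2 i, (k i < l i)%N & forall j : 'I_n, (i < j)%N -> k j = l j].

Definition positive_roots_enum (m : nat) (beta : 'I_m -> hdual H) : Prop :=
  (forall b, positive_root b <-> exists i, b = beta i) /\
  forall i j : 'I_m, (i < j)%N -> lex_lt (beta i) (beta j).

End Base.

Definition sl2_triple (e f h : g) : Prop :=
  [/\ e != 0, [[e, f]] = h, [[h, e]] = 2%:R *: e & [[h, f]] = - (2%:R *: f)].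

Definition root_vectors H n (alpha : n.-tuple (hdual H)) (X Y h : hdual H -> g) :=
  forall b, positive_root alpha b ->
    [/\ in_root_space b (X b), in_root_space (- b) (Y b) &
        sl2_triple (X b) (Y b) (h b)].

Record invariant_form := InvariantForm {
  iform :> g -> g -> K;
  iform_linearl : forall a x y z, iform (a *: x + y) z = a * iform x z + iform y z;
  iformC : forall x y, iform x y = iform y x;
  iform_invariant : forall x y z, iform [[x, y]] z = iform x [[y, z]];
  iform_nondegenerate : forall x, (forall y, iform x y = 0) -> x = 0
}.

End Structure.

(* [V] tensored with the Laurent polynomials: [f k] is the coefficient
   of [t^k]. *)
Record loop (V : zmodType) := Loop { loop_fsfun : {fsfun int -> V with 0} }.

Section LoopZmod.
Variable V : zmodType.
HB.instance Definition _ := [isNew for @loop_fsfun V].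
HB.instance Definition _ := [Choice of loop V by <:].

Definition loop_coef (f : loop V) (k : int) : V := loop_fsfun f k.
Local Coercion loop_coef : loop >-> Funclass.
Definition loop_supp (f : loop V) : {fset int} := finsupp (loop_fsfun f).

Lemma loopP (f g : loop V) : (forall k, f k = g k) <-> f = g.
Proof. by case: f g => [f] [g]; split=> [fg | -> //]; congr Loop; apply/fsfunP. Qed.

Lemma loop_suppN (f : loop V) k : k \notin loop_supp f -> f k = 0.
Proof. exact: fsfun_dflt. Qed.

Definition loop0 : loop V := Loop [fsfun].
Definition loop_add (f g : loop V) : loop V :=
  Loop [fsfun k in loop_supp f `|` loop_supp g => f k + g k].
Definition loop_opp (f : loop V) : loop V := Loop [fsfun k in loop_supp f => - f k].
Definition loop_mono (x : V) (r : int) : loop V := Loop [fsfun k in [fset r] => x].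

Lemma loop0E k : loop0 k = 0. Proof. exact: fsfun0E. Qed.

Lemma loop_addE f g k : loop_add f g k = f k + g k.
Proof.
rewrite [LHS]fsfun_fun; case: ifPn => //.
by rewrite in_fsetU negb_or => /andP[/loop_suppN fk /loop_suppN gk]; rewrite fk gk addr0.
Qed.

Lemma loop_oppE f k : loop_opp f k = - f k.
Proof.
rewrite [LHS]fsfun_fun; case: ifPn => // /loop_suppN fk.
by rewrite fk oppr0.
Qed.

Lemma loop_monoE x r k : loop_mono x r k = if k == r then x else 0.
Proof. by rewrite [LHS]fsfun_fun in_fset1. Qed.

Lemma loop_addA : associative loop_add.
Proof. by move=> f g h; apply/loopP => k; rewrite !loop_addE addrA. Qed.
Lemma loop_addC : commutative loop_add.
Proof. by move=> f g; apply/loopP => k; rewrite !loop_addE addrC. Qed.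
Lemma loop_add0 : left_id loop0 loop_add.
Proof. by move=> f; apply/loopP => k; rewrite loop_addE loop0E add0r. Qed.
Lemma loop_addN : left_inverse loop0 loop_opp loop_add.
Proof. by move=> f; apply/loopP => k; rewrite loop_addE loop_oppE loop0E addNr. Qed.

HB.instance Definition _ := GRing.isZmodule.Build (loop V)
  loop_addA loop_addC loop_add0 loop_addN.

Lemma loopDE (f g : loop V) k : (f + g) k = f k + g k.
Proof. exact: loop_addE. Qed.

Lemma loopNE (f : loop V) k : (- f) k = - f k.
Proof. exact: loop_oppE. Qed.

Lemma loop_supp_mono x r : loop_supp (loop_mono x r) `<=` [fset r].
Proof. exact: finsupp_sub. Qed.

Lemma loop_expand (f : loop V) : f = \sum_(k <- loop_supp f) loop_mono (f k) k.
Proof.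
have sumE s r : (\sum_(k <- s) loop_mono (f k) k) r = \sum_(k <- s) loop_mono (f k) k r.
  elim: s => [|k s IHs]; first by rewrite !big_nil; exact: loop0E.
  by rewrite !big_cons -IHs; exact: loopDE.
apply/loopP => r; rewrite sumE.
under eq_bigr do rewrite loop_monoE eq_sym.
rewrite -big_mkcond /=; have [rf | /[dup] rf /loop_suppN ->] := boolP (r \in loop_supp f).
  by rewrite (big_rem r) //= eqxx big1_seq ?addr0 // => k /andP[/eqP ->]; rewrite mem_rem_uniq ?fset_uniq // inE eqxx.
rewrite big1_seq // => k /andP[/eqP -> ]; by rewrite (negbTE rf).
Qed.

Lemma loop_ind (P : loop V -> Prop) :
  P 0 -> (forall f g, P f -> P g -> P (f + g)) ->
  (forall x r, P (loop_mono x r)) -> forall f, P f.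
Proof. by move=> P0 PD Pm f; rewrite (loop_expand f); elim/big_ind: _. Qed.

(* Sums over the support may be computed on any larger finite set. *)
Lemma loop_sumE (W : zmodType) (F : int -> V -> W) (f : loop V) (S : {fset int}) :
  (forall k, F k 0 = 0) -> loop_supp f `<=` S ->
  \sum_(k <- loop_supp f) F k (f k) = \sum_(k <- S) F k (f k).
Proof.
move=> F0 /fsubsetP fS; rewrite [RHS](bigID (mem (loop_supp f))) /=.
rewrite [X in _ + X]big1 ?addr0 => [|k /loop_suppN -> //].
rewrite -[RHS]big_filter; apply: perm_big; apply: uniq_perm.
- exact: fset_uniq.
- by rewrite filter_uniq ?fset_uniq.
by move=> k; rewrite mem_filter; case: (boolP (k \in loop_supp f)) => //= /fS ->.
Qed.

Lemma loop_sumD (W : zmodType) (F : int -> V -> W) (f g : loop V) :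
  (forall k x y, F k (x + y) = F k x + F k y) ->
  \sum_(k <- loop_supp (f + g)) F k ((f + g) k) =
  \sum_(k <- loop_supp f) F k (f k) + \sum_(k <- loop_supp g) F k (g k).
Proof.
move=> FD; have F0 k : F k 0 = 0 by apply: (addrI (F k 0)); rewrite -FD !addr0.
pose S := loop_supp f `|` loop_supp g.
rewrite !(loop_sumE (S := S)) ?fsubsetUl ?fsubsetUr //; last exact: finsupp_sub.
by rewrite -big_split; apply: eq_bigr => k _; rewrite loopDE FD.
Qed.

Lemma loop_sum_mono (W : zmodType) (F : int -> V -> W) x r :
  (forall k, F k 0 = 0) ->
  \sum_(k <- loop_supp (loop_mono x r)) F k (loop_mono x r k) = F r x.
Proof.
move=> F0; rewrite (loop_sumE F0 (loop_supp_mono x r)) big_seq_fset1.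
by rewrite loop_monoE eqxx.
Qed.

End LoopZmod.

Section LoopLmod.
Variables (K : fieldType) (V : lmodType K).
Local Coercion loop_coef : loop >-> Funclass.

Definition loop_scale (a : K) (f : loop V) : loop V :=
  Loop [fsfun k in loop_supp f => a *: f k].

Lemma loop_scaleE a f k : loop_scale a f k = a *: f k.
Proof.
rewrite [LHS]fsfun_fun; case: ifPn => // /loop_suppN fk.
by rewrite fk scaler0.
Qed.

Lemma loop_scaleA a b f : loop_scale a (loop_scale b f) = loop_scale (a * b) f.
Proof. by apply/loopP => k; rewrite !loop_scaleE scalerA. Qed.
Lemma loop_scale1 : left_id 1 loop_scale.
Proof. by move=> f; apply/loopP => k; rewrite loop_scaleE scale1r. Qed.
Lemma loop_scaleDr : right_distributive loop_scale +%R.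
Proof. by move=> a f g; apply/loopP => k; rewrite loopDE !loop_scaleE loopDE scalerDr. Qed.
Lemma loop_scaleDl f : {morph loop_scale^~ f : a b / a + b}.
Proof. by move=> a b; apply/loopP => k; rewrite loopDE !loop_scaleE scalerDl. Qed.

HB.instance Definition _ := GRing.Zmodule_isLmodule.Build K (loop V)
  loop_scaleA loop_scale1 loop_scaleDr loop_scaleDl.

Lemma loopZE a (f : loop V) k : (a *: f) k = a *: f k.
Proof. exact: loop_scaleE. Qed.

Lemma loop_sumZ (W : lmodType K) (F : int -> V -> W) a (f : loop V) :
  (forall k x, F k (a *: x) = a *: F k x) -> (forall k, F k 0 = 0) ->
  \sum_(k <- loop_supp (a *: f)) F k ((a *: f) k) =
  a *: \sum_(k <- loop_supp f) F k (f k).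
Proof.
move=> FZ F0; rewrite (loop_sumE F0 (S := loop_supp f)); last exact: finsupp_sub.
by rewrite scaler_sumr; apply: eq_bigr => k _; rewrite loopZE FZ.
Qed.

End LoopLmod.

Section DerivedAffine.
Variables (K : fieldType) (g : finLieType K) (B : invariant_form g).
Local Coercion loop_coef : loop >-> Funclass.
Implicit Types (f : loop g) (x y z : g) (r s : int).

Lemma iform0l y : B 0 y = 0.
Proof. by have := iform_linearl B (-1) 0 0 y; rewrite scaleN1r addNr mulN1r addNr. Qed.
Lemma iformDl x y z : B (x + y) z = B x z + B y z.
Proof. by have := iform_linearl B 1 x y z; rewrite scale1r mul1r. Qed.
Lemma iformZl a x z : B (a *: x) z = a * B x z.
Proof. by have := iform_linearl B a x 0 z; rewrite iform0l !addr0. Qed.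
Lemma iform0r x : B x 0 = 0. Proof. by rewrite iformC iform0l. Qed.
Lemma iformDr x y z : B x (y + z) = B x y + B x z.
Proof. by rewrite iformC iformDl !(iformC B x). Qed.
Lemma iformZr a x z : B x (a *: z) = a * B x z.
Proof. by rewrite iformC iformZl (iformC B x). Qed.

(* The bilinear extension of [x t^k, y t^l |-> [[x, y]] t^(k + l)]. *)
Definition loop_lie f1 f2 : loop g :=
  Loop [fsfun n in [fset k + l | k in loop_supp f1, l in loop_supp f2] =>
    \sum_(k <- loop_supp f1) [[f1 k, f2 (n - k)]]].

(* The bilinear extension of [x t^k, y t^l |-> delta_(k + l, 0) k (x | y)]. *)
Definition loop_cocycle f1 f2 : K^o :=
  \sum_(k <- loop_supp f1) k%:~R * B (f1 k) (f2 (- k)).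

Lemma loop_lieE f1 f2 n :
  loop_lie f1 f2 n = \sum_(k <- loop_supp f1) [[f1 k, f2 (n - k)]].
Proof.
rewrite [LHS]fsfun_fun; case: ifPn => // nS.
rewrite big_seq big1 // => k kf1.
rewrite (@loop_suppN _ f2) ?lie0r //; apply: contra nS => kf2.
by apply/imfset2P; exists k => //; exists (n - k) => //; rewrite addrC subrK.
Qed.

Lemma loop_lieDl f1 f2 f : loop_lie (f1 + f2) f = loop_lie f1 f + loop_lie f2 f.
Proof.
apply/loopP => n; rewrite loopDE !loop_lieE.
by rewrite (@loop_sumD _ _ (fun k x => [[x, f (n - k)]])) // => *; exact: lieDl.
Qed.

Lemma loop_lieZl a f1 f : loop_lie (a *: f1) f = a *: loop_lie f1 f.
Proof.
apply/loopP => n; rewrite loopZE !loop_lieE.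
by rewrite (@loop_sumZ _ _ _ (fun k x => [[x, f (n - k)]])) // => *;
  rewrite ?lieZl ?lie0l.
Qed.

Lemma loop_lieDr f f1 f2 : loop_lie f (f1 + f2) = loop_lie f f1 + loop_lie f f2.
Proof.
apply/loopP => n; rewrite loopDE !loop_lieE -big_split.
by apply: eq_bigr => k _; rewrite loopDE lieDr.
Qed.

Lemma loop_lieZr a f f1 : loop_lie f (a *: f1) = a *: loop_lie f f1.
Proof.
apply/loopP => n; rewrite loopZE !loop_lieE scaler_sumr.
by apply: eq_bigr => k _; rewrite loopZE lieZr.
Qed.

Lemma loop_lie0l f : loop_lie 0 f = 0.
Proof. by rewrite -(scale0r (0 : loop g)) loop_lieZl !scale0r. Qed.

Lemma loop_lie0r f : loop_lie f 0 = 0.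
Proof. by rewrite -(scale0r (0 : loop g)) loop_lieZr !scale0r. Qed.

Lemma loop_lie_mono x y r s :
  loop_lie (loop_mono x r) (loop_mono y s) = loop_mono [[x, y]] (r + s).
Proof.
apply/loopP => n; rewrite loop_lieE.
rewrite (@loop_sum_mono _ _ (fun k x => [[x, loop_mono y s (n - k)]])); last first.
  by move=> k; rewrite lie0l.
by rewrite !loop_monoE subr_eq (addrC s); case: eqP; rewrite ?lie0r.
Qed.

Lemma loop_cocycleDl f1 f2 f :
  loop_cocycle (f1 + f2) f = loop_cocycle f1 f + loop_cocycle f2 f.
Proof.
rewrite /loop_cocycle (@loop_sumD _ _ (fun k x => k%:~R * B x (f (- k)))) // => *.
by rewrite iformDl mulrDr.
Qed.

Lemma loop_cocycleZl a f1 f : loop_cocycle (a *: f1) f = a * loop_cocycle f1 f.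
Proof.
rewrite /loop_cocycle.
rewrite (@loop_sumZ _ _ K^o (fun k x => k%:~R * B x (f (- k)))) // => *.
  by rewrite iformZl mulrCA.
by rewrite iform0l mulr0.
Qed.

Lemma loop_cocycleDr f f1 f2 :
  loop_cocycle f (f1 + f2) = loop_cocycle f f1 + loop_cocycle f f2.
Proof.
rewrite /loop_cocycle -big_split; apply: eq_bigr => k _.
by rewrite loopDE iformDr mulrDr.
Qed.

Lemma loop_cocycleZr a f f1 : loop_cocycle f (a *: f1) = a * loop_cocycle f f1.
Proof.
rewrite /loop_cocycle mulr_sumr; apply: eq_bigr => k _.
by rewrite loopZE iformZr mulrCA.
Qed.

Lemma loop_cocycle0l f : loop_cocycle 0 f = 0.
Proof. by rewrite -(scale0r (0 : loop g)) loop_cocycleZl mul0r. Qed.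

Lemma loop_cocycle0r f : loop_cocycle f 0 = 0.
Proof. by rewrite -(scale0r (0 : loop g)) loop_cocycleZr mul0r. Qed.

Lemma loop_cocycle_mono x y r s :
  loop_cocycle (loop_mono x r) (loop_mono y s) =
  if r + s == 0 then r%:~R * B x y else 0.
Proof.
rewrite /loop_cocycle.
rewrite (@loop_sum_mono _ _ (fun k x => k%:~R * B x (loop_mono y s (- k)))); last first.
  by move=> k; rewrite iform0l mulr0.
rewrite loop_monoE eq_sym -addr_eq0 addrC.
by case: eqP => //; rewrite iform0r mulr0.
Qed.

Definition derived_affine_of & invariant_form g : Type := (loop g * K^o)%type.

(* [g (x) C[t, t^-1] + C c]; the second component is the coefficient of [c]. *)
Definition derived_affine : Type := derived_affine_of B.
HB.instance Definition _ := GRing.Lmodule.copy derived_affine (loop g * K^o)%type.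

Definition affine_lie (u v : derived_affine) : derived_affine :=
  (loop_lie u.1 v.1, loop_cocycle u.1 v.1).

Lemma affine_lie_linear u : linear (affine_lie u).
Proof.
move=> a v w; congr (_, _); first by rewrite loop_lieDr loop_lieZr.
by rewrite loop_cocycleDr loop_cocycleZr.
Qed.

Lemma affine_lie_linearl v : linear (affine_lie^~ v).
Proof.
move=> a u w; congr (_, _); first by rewrite loop_lieDl loop_lieZl.
by rewrite loop_cocycleDl loop_cocycleZl.
Qed.

Lemma loop_lieC f1 f2 : loop_lie f1 f2 = - loop_lie f2 f1.
Proof.
elim/loop_ind: f1 => [|f f' IH IH'|x r].
- by rewrite loop_lie0l loop_lie0r oppr0.
- by rewrite loop_lieDl loop_lieDr opprD IH IH'.
elim/loop_ind: f2 => [|f f' IH IH'|y s].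
- by rewrite loop_lie0l loop_lie0r oppr0.
- by rewrite loop_lieDl loop_lieDr opprD IH IH'.
rewrite !loop_lie_mono (lieC x) (addrC s); apply/loopP => k.
by rewrite loopNE !loop_monoE; case: ifP; rewrite ?oppr0.
Qed.

Lemma loop_cocycleC f1 f2 : loop_cocycle f1 f2 = - loop_cocycle f2 f1.
Proof.
elim/loop_ind: f1 => [|f f' IH IH'|x r].
- by rewrite loop_cocycle0l loop_cocycle0r oppr0.
- by rewrite loop_cocycleDl loop_cocycleDr opprD IH IH'.
elim/loop_ind: f2 => [|f f' IH IH'|y s].
- by rewrite loop_cocycle0l loop_cocycle0r oppr0.
- by rewrite loop_cocycleDl loop_cocycleDr opprD IH IH'.
rewrite !loop_cocycle_mono (addrC s) iformC.
by case: eqP => [/eqP|]; rewrite ?oppr0 // addr_eq0 => /eqP ->; rewrite mulrNz mulNr.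
Qed.

Lemma affine_liexx u : affine_lie u u = 0.
Proof.
case: u => f c; congr (_, _) => /=.
  elim/loop_ind: f => [|f f' IH IH'|x r]; first by rewrite loop_lie0l.
    rewrite loop_lieDl !loop_lieDr IH IH' add0r addr0.
    by rewrite (loop_lieC f) addNr.
  rewrite loop_lie_mono liexx; apply/loopP => k.
  by rewrite loop_monoE if_same; apply/esym/loop0E.
elim/loop_ind: f => [|f f' IH IH'|x r]; first by rewrite loop_cocycle0l.
  rewrite loop_cocycleDl !loop_cocycleDr IH IH' add0r addr0.
  by rewrite (loop_cocycleC f) addNr.
rewrite loop_cocycle_mono -mulr2n mulrn_eq0 /=.
by case: eqP => // ->; rewrite mul0r.
Qed.

Lemma affine_lie_jacobi u v w :
  affine_lie u (affine_lie v w) + affine_lie v (affine_lie w u)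
  + affine_lie w (affine_lie u v) = 0.
Proof.
case: u v w => [f1 c1] [f2 c2] [f3 c3]; congr (_, _) => /=.
  pose J a b c := loop_lie a (loop_lie b c) + loop_lie b (loop_lie c a)
                  + loop_lie c (loop_lie a b).
  have JC a b c : J a b c = J b c a by rewrite /J -addrA addrC.
  have JD a a' b c : J (a + a') b c = J a b c + J a' b c.
    rewrite /J !(loop_lieDl, loop_lieDr).
    by rewrite [X in X + _ = _]addrACA [LHS]addrACA.
  have J0 b c : J 0 b c = 0.
    by rewrite /J !(loop_lie0l, loop_lie0r) !addr0.
  rewrite -/(J f1 f2 f3); elim/loop_ind: f1 => [|a b IH IH'|x r];
  [exact: J0 | by rewrite JD IH IH' addr0 |].
  rewrite JC; elim/loop_ind: f2 => [|a b IH IH'|y s];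
  [exact: J0 | by rewrite JD IH IH' addr0 |].
  rewrite JC; elim/loop_ind: f3 => [|a b IH IH'|z t];
  [exact: J0 | by rewrite JD IH IH' addr0 |].
  rewrite /J !loop_lie_mono.
  have -> : r + (s + t) = t + (r + s) by rewrite addrA addrC.
  have -> : s + (t + r) = t + (r + s) by rewrite addrCA (addrC s).
  apply/loopP => k; rewrite !loopDE !loop_monoE [RHS]loop0E.
  by case: ifP; rewrite ?addr0 // lie_jacobi.
pose J a b c := loop_cocycle a (loop_lie b c) + loop_cocycle b (loop_lie c a)
                + loop_cocycle c (loop_lie a b).
have JC a b c : J a b c = J b c a by rewrite /J -addrA addrC.
have JD a a' b c : J (a + a') b c = J a b c + J a' b c.
  rewrite /J !(loop_lieDl, loop_lieDr, loop_cocycleDl, loop_cocycleDr).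
  by rewrite [X in X + _ = _]addrACA [LHS]addrACA.
have J0 b c : J 0 b c = 0.
  by rewrite /J !(loop_lie0l, loop_lie0r, loop_cocycle0l, loop_cocycle0r) !addr0.
rewrite -/(J f1 f2 f3); elim/loop_ind: f1 => [|a b IH IH'|x r];
  [exact: J0 | by rewrite JD IH IH' addr0 |].
rewrite JC; elim/loop_ind: f2 => [|a b IH IH'|y s];
  [exact: J0 | by rewrite JD IH IH' addr0 |].
rewrite JC; elim/loop_ind: f3 => [|a b IH IH'|z t];
  [exact: J0 | by rewrite JD IH IH' addr0 |].
rewrite /J !loop_lie_mono !loop_cocycle_mono.
have -> : r + (s + t) = t + (r + s) by rewrite addrA addrC.
have -> : s + (t + r) = t + (r + s) by rewrite addrCA (addrC s).
have yz : B x [[y, z]] = B z [[x, y]] by rewrite -iform_invariant iformC.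
have zx : B y [[z, x]] = B z [[x, y]] by rewrite iformC iform_invariant.
case: eqP => [rst|]; last by rewrite !addr0.
by rewrite yz zx -!mulrDl -!intrD -addrA rst mul0r.
Qed.

HB.instance Definition _ := Lmodule_isLie.Build K derived_affine
  affine_lie_linear affine_lie_linearl affine_liexx affine_lie_jacobi.

Definition affine_elt (x : g) (r : int) : derived_affine := (loop_mono x r, 0).

End DerivedAffine.

Notation multiplicity := {fsfun int -> nat with 0%N}.

(* The term [c * prod_s y_s ^ p(s)] in commuting variables [y_s] is encoded as
   [(c, p)]; [mderiv s] is its formal derivative with respect to [y_s]. *)
Definition mterm : Type := (nat * multiplicity)%type.

Definition mderiv (s : int) (m : mterm) : mterm :=
  ((m.1 * m.2 s)%N, [fsfun m.2 with s |-> (m.2 s).-1]).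

Section Monomials.
Variables (K : fieldType) (g : finLieType K) (B : invariant_form g).

Definition aff (x : g) (r : int) : uenv (derived_affine B) :=
  ugen (affine_elt B x r).

(* The factors commute in the intended use, so the order is immaterial. *)
Definition ymon (y : g) (p : multiplicity) : uenv (derived_affine B) :=
  \prod_(s <- finsupp p) aff y s ^+ p s.

Definition mval (y : g) (m : mterm) : uenv (derived_affine B) :=
  ymon y m.2 *+ m.1.

Definition ymon_d (y : g) (p : multiplicity) (s : int) :=
  mval y (mderiv s (1%N, p)).

Definition ymon_dd (y : g) (p : multiplicity) (s1 s2 : int) :=
  mval y (mderiv s1 (mderiv s2 (1%N, p))).

End Monomials.

Definition supp_opp (p : multiplicity) : {fset int} := [fset - s | s in finsupp p].

Definition commutator (A : nzRingType) (a b : A) : A := a * b - b * a.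

(* Main.v *)
(* The coroot h_b centralises H by the Jacobi identity, hence lies in H, which is
   its own normaliser; so b(h_b) = 2. Invariance of the form gives
   B(h_a, Y_b) = B(Y_b, Y_b) = 0, and r + s <> 0 on the support, so no central
   term ever appears: the Y_b(s) commute, [X_b(r), Y_b(s)] = h_b(r + s) and
   [h_a(k), Y_b(s)] = - b(h_a) Y_b(k + s). Part (1) then follows by multiplying
   the monomial by one factor Y_b(t) at a time. In part (2), apply (1) to the
   first monomial and move each h(r + s) to the right through the remaining ones
   by the Leibniz rule. *)

Require Import Defs.
From mathcomp Require Import all_boot all_order all_algebra finmap reals complex.

Import GRing.Theory.
Local Open Scope ring_scope.

Set Implicit Arguments.
Unset Strict Implicit.
Unset Printing Implicit Defensive.

(** * Ordered products and commutators in noncommutative rings *)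

Lemma prodr_rem_comm (A : pzSemiRingType) (I : eqType) (f : I -> A) (x : I)
    (s : seq I) :
  (forall i j, GRing.comm (f i) (f j)) -> x \in s ->
  \prod_(i <- s) f i = f x * \prod_(i <- rem x s) f i.
Proof.
move=> fC; elim: s => // y s IHs; rewrite inE big_cons /= eq_sym.
case: eqVneq => [-> // | _ /= xs]; rewrite big_cons IHs // !mulrA.
by congr (_ * _); exact: fC.
Qed.

Lemma perm_prodr_comm (A : pzSemiRingType) (I : eqType) (f : I -> A)
    (s t : seq I) :
  (forall i j, GRing.comm (f i) (f j)) -> perm_eq s t ->
  \prod_(i <- s) f i = \prod_(i <- t) f i.
Proof.
move=> fC; elim: s t => [|x s IHs] t st.
  by rewrite perm_sym in st; rewrite (perm_nilP st).
have xt : x \in t by rewrite -(perm_mem st) mem_head.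
rewrite big_cons (prodr_rem_comm fC xt); congr (_ * _); apply: IHs.
by rewrite -(perm_cons x) (perm_trans st) ?perm_to_rem.
Qed.

Lemma commutatorMl (A : nzRingType) (a b c : A) :
  commutator (a * b) c = commutator a c * b + a * commutator b c.
Proof. by rewrite /commutator mulrBl mulrBr !mulrA [RHS]addrC subrKA. Qed.

(** Leibniz rule for the derivation [commutator _ a]. The test [j == t] must mark a single
    differentiated factor, hence [uniq s]. *)
Lemma commutator_prodl (A : nzRingType) (I : eqType) (f : I -> A) (a : A)
    (P : pred I) (s : seq I) :
  uniq s ->
  commutator (\prod_(j <- s | P j) f j) a =
  \sum_(t <- s | P t)
    \prod_(j <- s | P j) (if j == t then commutator (f j) a else f j).
Proof.
elim: s => [_ | x s IHs /= /andP[xs us] ].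
  by rewrite !big_nil /commutator mul1r mulr1 subrr.
rewrite !big_cons; case: ifP => [Px | Px]; last first.
  by rewrite IHs //; apply: eq_bigr => t _; rewrite big_cons Px.
rewrite commutatorMl IHs // eqxx; congr (_ * _ + _).
  rewrite [LHS]big_seq_cond [RHS]big_seq_cond; apply: eq_bigr => j /andP[js _].
  rewrite ifN //.
  by apply: contraNneq xs => <-.
rewrite mulr_sumr [LHS]big_seq_cond [RHS]big_seq_cond.
apply: eq_bigr => t /andP[ts _]; rewrite big_cons Px ifN //.
by apply: contraNneq xs => ->.
Qed.

(** Factors need not commute, so position matters: [index_enum] lists ordinals increasingly, which
    puts [i] first. The two filtered lists are strictly sorted with the same members, hence
    equal. *)
Lemma prodr_ord_ge (A : pzSemiRingType) (m : nat) (i : 'I_m) (f : 'I_m -> A) :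
  \prod_(j < m | (i <= j)%N) f j = f i * \prod_(j < m | (i < j)%N) f j.
Proof.
pose lt (j k : 'I_m) := (j < k)%N.
have lt_tr : transitive lt by move=> x y z; exact: ltn_trans.
have Is : sorted lt (index_enum 'I_m).
  have := iota_ltn_sorted 0 m; rewrite -val_enum_ord sorted_map.
  by rewrite enumT; congr sorted.
suff ge_lt : [seq j : 'I_m <- index_enum 'I_m | (i <= j)%N]
    = i :: [seq j : 'I_m <- index_enum 'I_m | (i < j)%N].
  by rewrite -big_filter ge_lt big_cons big_filter.
apply: (irr_sorted_eq lt_tr).
- by move=> x; exact: ltnn.
- exact: sorted_filter.
- have := sorted_filter lt_tr (fun j : 'I_m => (i < j)%N) Is.
  rewrite /= path_sortedE // => ->; rewrite andbT.
  by apply/allP => j; rewrite mem_filter => /andP[].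
by move=> j; rewrite inE !mem_filter mem_index_enum !andbT leq_eqVlt eq_sym.
Qed.

(** * Exponent functions and induction on monomials *)

Implicit Types (p : multiplicity) (s t : int).

(** Exponents after multiplication by one more [y_t]. Its counterpart [mult_dec] is the exponent
    part of [mderiv t], truncated at 0, where the coefficient [p t] vanishes anyway. *)
Definition mult_inc (p : multiplicity) (t : int) : multiplicity :=
  [fsfun p with t |-> (p t).+1].
Definition mult_dec (p : multiplicity) (t : int) : multiplicity :=
  [fsfun p with t |-> (p t).-1].

Lemma mult_incE p t s : mult_inc p t s = (p s + (s == t))%N.
Proof. by rewrite fsfun_withE; case: eqP => [->|]; rewrite ?addn1 ?addn0. Qed.

Lemma mult_decE p t s : mult_dec p t s = (p s - (s == t))%N.
Proof. by rewrite fsfun_withE; case: eqP => [->|]; rewrite ?subn1 ?subn0. Qed.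

Lemma mult_incK p t : mult_dec (mult_inc p t) t = p.
Proof. by apply/fsfunP => s; rewrite mult_decE mult_incE addnK. Qed.

Lemma mult_decK p t : (0 < p t)%N -> mult_inc (mult_dec p t) t = p.
Proof.
move=> pt; apply/fsfunP => s; rewrite mult_incE mult_decE subnK //.
by case: eqP => // ->.
Qed.

Lemma mult_dec_inc p s t :
  s != t -> mult_dec (mult_inc p t) s = mult_inc (mult_dec p s) t.
Proof.
move=> st; apply/fsfunP => u; rewrite !(mult_decE, mult_incE).
case: (eqVneq u s) => [-> | _]; last by rewrite !subn0.
by rewrite (negbTE st) !addn0.
Qed.

(** Induction on the total degree, inside a fixed set [S]: sums over [S] occurring in [P] keep their
    index set while the exponents grow. *)
Lemma mult_ind (S : {fset int}) (P : multiplicity -> Prop) :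
  P [fsfun] -> (forall p t, t \in S -> P p -> P (mult_inc p t)) ->
  forall p : multiplicity, (finsupp p `<=` S)%fset -> P p.
Proof.
move=> P0 PS p; move: {2}(\sum_(s <- S) p s)%N (erefl (\sum_(s <- S) p s)%N) => N.
elim: N p => [|N IHN] p pN pS.
  suff -> : p = [fsfun] by [].
  apply/fsfunP => s; rewrite fsfun0E; apply/eqP; apply: contra_eqT pN => ps.
  have sS : s \in S by apply: (fsubsetP pS); rewrite mem_finsupp.
  by rewrite (big_fsetD1 s) //= addn_eq0 negb_and ps.
have [t tp] : exists t, t \in finsupp p.
  apply/fset0Pn; apply: contra_eqN pN => /eqP p0.
  by rewrite big1 // => s _; apply: fsfun_dflt; rewrite p0.
have tS := fsubsetP pS _ tp.
have pt : (0 < p t)%N by rewrite lt0n -mem_finsupp.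
rewrite -(mult_decK pt); apply: PS => //; apply: IHN.
  apply: succn_inj; rewrite -pN !(big_fsetD1 t tS) /= mult_decE eqxx.
  rewrite -addSn subn1 prednK //; congr (_ + _)%N.
  by apply: eq_big_seq => s; rewrite !inE mult_decE => /andP[/negbTE -> _]; rewrite subn0.
apply/fsubsetP => s; rewrite mem_finsupp mult_decE => ps; apply: (fsubsetP pS).
by rewrite mem_finsupp; apply: contraNneq ps => ->.
Qed.

(** Collapses the Kronecker deltas left by differentiating a newly appended factor. *)
Lemma sum_delta (A : pzSemiRingType) (S : {fset int}) t (F G : int -> A) :
  t \in S -> \sum_(s <- S) (F s *+ (s == t)) * G s = F t * G t.
Proof.
move=> tS; rewrite (eq_bigr (fun s => if s == t then F s * G s else 0)).
  by rewrite -big_mkcond -big_filter filter_pred1_uniq ?big_seq1 ?fset_uniq.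
by move=> s _; case: eqP; rewrite ?mul0r.
Qed.

(** * Moving loop elements past a monomial in commuting variables *)

Section Monomials.
Variables (K : fieldType) (g : finLieType K) (B : invariant_form g).
Implicit Types (x y z : g) (S : {fset int}).

(** The central term is supported on [r + s = 0] and proportional to [B x y], so either alternative
    removes it. *)
Lemma aff_swap x y r s :
  r + s != 0 \/ B x y = 0 ->
  aff B x r * aff B y s = aff B y s * aff B x r + aff B [[x, y]] (r + s).
Proof.
move=> rsB; apply/eqP; rewrite addrC -subr_eq; apply/eqP.
rewrite /aff ugen_lie; congr ugen; congr (_, _); first exact: loop_lie_mono.
rewrite [LHS]loop_cocycle_mono; case: rsB => [/negbTE -> // | ->].
by rewrite mulr0 if_same.
Qed.

Lemma affZ a x r : aff B (a *: x) r = a *: aff B x r.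
Proof.
rewrite /aff -linearZ; congr ugen; congr (_, _); last by rewrite /= scaler0.
apply/loopP => k; rewrite loopZE !loop_monoE.
by case: ifP; rewrite ?scaler0.
Qed.

Lemma aff0 r : aff B 0 r = 0.
Proof. by rewrite -(scale0r (0 : g)) affZ scale0r. Qed.

Section CommutingFactors.
Variable y : g.
Hypothesis yC : forall s t, GRing.comm (aff B y s) (aff B y t).

(** Indices outside the support contribute [y ^ 0 = 1]; monomials with different supports can thus
    be compared over one index set. *)
Lemma ymonE p S :
  (finsupp p `<=` S)%fset -> ymon B y p = \prod_(s <- S) aff B y s ^+ p s.
Proof.
move=> pS; have fC s t : GRing.comm (aff B y s ^+ p s) (aff B y t ^+ p t).
  by apply: commrX; apply: commr_sym; apply: commrX.
have /(perm_prodr_comm fC) -> :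
    perm_eq S (finsupp p ++ [seq s <- S | s \notin finsupp p]).
  apply: (@perm_trans _ ([seq s <- S | s \in finsupp p]
                           ++ [seq s <- S | s \notin finsupp p])).
    by rewrite perm_sym perm_filterC.
  rewrite perm_cat2r; apply: uniq_perm; rewrite ?filter_uniq ?fset_uniq //.
  by move=> s; rewrite mem_filter; case: (boolP (s \in finsupp p)) => //= /(fsubsetP pS).
rewrite big_cat /= [X in _ = _ * X]big_filter.
rewrite [X in _ = _ * X]big1 ?mulr1 // => s sp.
by rewrite (fsfun_dflt sp).
Qed.

Lemma ymon_inc p t : ymon B y (mult_inc p t) = ymon B y p * aff B y t.
Proof.
pose S : {fset int} := (t |` finsupp p)%fset.
rewrite (@ymonE _ S) ?(@ymonE p S) ?fsubsetUr //; last first.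
  apply/fsubsetP => s; rewrite !inE !mem_finsupp mult_incE.
  by case: (eqVneq s t) => //= _; rewrite addn0.
under eq_bigr do rewrite mult_incE exprD.
rewrite prodrM_comm; last first.
  by move=> *; apply: commrX; apply: commr_sym; apply: commrX.
congr (_ * _); rewrite (eq_bigr (fun s => if s == t then aff B y s else 1)).
  by rewrite -big_mkcond -big_filter filter_pred1_uniq ?big_seq1 ?fset_uniq ?fset1U1.
by move=> s _; case: eqP.
Qed.

Lemma ymon0 : ymon B y [fsfun] = 1.
Proof. by rewrite /ymon finsupp0 big_seq_fset0. Qed.

Lemma ymon_dE p s : ymon_d B y p s = ymon B y (mult_dec p s) *+ p s.
Proof. by rewrite /ymon_d /mval /= mul1n. Qed.

Lemma ymon_ddE p s1 s2 :
  ymon_dd B y p s1 s2 = ymon_d B y (mult_dec p s2) s1 *+ p s2.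
Proof. by rewrite ymon_dE /ymon_dd /mval /= mul1n mulnC mulrnA. Qed.

Lemma ymon_d_inc p t s :
  ymon_d B y (mult_inc p t) s
  = ymon_d B y p s * aff B y t + ymon B y p *+ (s == t).
Proof.
rewrite !ymon_dE mult_incE; case: eqVneq => [-> | st]; last first.
  by rewrite addn0 addr0 mult_dec_inc // ymon_inc mulrnAl.
rewrite mult_incK mulrnDr mulrnAl -ymon_inc; congr (_ + _).
(* For [p t = 0] the truncated decrement is not undone by the increment, but both sides carry the
   coefficient 0. *)
by case: (posnP (p t)) => [-> // | pt]; rewrite mult_decK.
Qed.

(** Product rule applied twice; the appended factor is linear, so it is never differentiated
    twice. *)
Lemma ymon_dd_inc p t s1 s2 :
  ymon_dd B y (mult_inc p t) s1 s2
  = ymon_dd B y p s1 s2 * aff B y t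
    + ymon_d B y p s1 *+ (s2 == t) + ymon_d B y p s2 *+ (s1 == t).
Proof.
rewrite !ymon_ddE mult_incE mulrnAl (ymon_dE p s2) addrAC [X in _ = _ + X + _]mulrnAC -mulrnDl.
rewrite -ymon_d_inc; case: eqVneq => [-> | st]; last first.
  by rewrite addn0 addr0 mult_dec_inc.
rewrite mult_incK mulrnDr; congr (_ + _).
by case: (posnP (p t)) => [-> // | pt]; rewrite mult_decK.
Qed.

(** Each bracket with a factor stays in the commuting family of the [y] variables, so it can be
    moved to the right end, leaving a derivative. *)
Lemma commutator_ymon x w k p :
  (forall s, commutator (aff B y s) (aff B x k) = w *: aff B y (k + s)) ->
  commutator (ymon B y p) (aff B x k)
  = w *: \sum_(s <- finsupp p) ymon_d B y p s * aff B y (k + s).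
Proof.
move=> yx; pose S := finsupp p.
apply: (@mult_ind S (fun q => commutator (ymon B y q) (aff B x k)
  = w *: \sum_(s <- S) ymon_d B y q s * aff B y (k + s))) => [|q t tS IHq|//].
  rewrite ymon0 /commutator mul1r mulr1 subrr big1 ?scaler0 // => s _.
  by rewrite ymon_dE fsfun0E mulr0n mul0r.
rewrite ymon_inc commutatorMl IHq yx.
under [in RHS]eq_bigr do rewrite ymon_d_inc mulrDl.
rewrite big_split (sum_delta (fun=> ymon B y q)) //= scalerDr -scalerAr -scalerAl mulr_suml.
congr (_ *: _ + _); apply: eq_bigr => s _; rewrite -!mulrA.
by congr (_ * _); exact: yC.
Qed.

(** Abstract form of (1): [x], [y], [z], [w] stand for [X b], [Y b], [h b], [b(h_b)], and only the
    exchange relations are kept. *)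
Lemma straighten_ymon x z w r p :
  2%:R != 0 :> K ->
  (forall s, s \in finsupp p ->
     aff B x r * aff B y s = aff B y s * aff B x r + aff B z (r + s)) ->
  (forall k s, aff B z k * aff B y s
     = aff B y s * aff B z k - w *: aff B y (k + s)) ->
  aff B x r * ymon B y p
  = ymon B y p * aff B x r
    + \sum_(s <- finsupp p) ymon_d B y p s * aff B z (r + s)
    - (w / 2%:R) *: \sum_(s1 <- finsupp p) \sum_(s2 <- finsupp p)
        ymon_dd B y p s1 s2 * aff B y (s1 + s2 + r).
Proof.
move=> nz2; move Sp: (finsupp p) => S xy zy.
apply: (@mult_ind S (fun q => aff B x r * ymon B y q
  = ymon B y q * aff B x r
    + \sum_(s <- S) ymon_d B y q s * aff B z (r + s)
    - (w / 2%:R) *: \sum_(s1 <- S) \sum_(s2 <- S)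
        ymon_dd B y q s1 s2 * aff B y (s1 + s2 + r))) => [|q t tS IHq|]; last first.
- by rewrite Sp.
(* [D] collects what is created when each [z(r + s)] passes the new factor [y_t]. It enters the
   first-order sum with weight [w] and the second-order sum twice, so the two contributions
   cancel. *)
- pose D := \sum_(s <- S) ymon_d B y q s * aff B y (r + s + t).
  have dE : \sum_(s <- S) ymon_d B y (mult_inc q t) s * aff B z (r + s)
      = (\sum_(s <- S) ymon_d B y q s * aff B z (r + s)) * aff B y t + w *: D
        + ymon B y q * aff B z (r + t).
    under eq_bigr do rewrite ymon_d_inc mulrDl.
    rewrite big_split (sum_delta (fun=> ymon B y q)) //=; congr (_ + _).
    rewrite mulr_suml scaler_sumr -big_split; apply: eq_bigr => s _ /=.
    by rewrite -[in RHS]mulrA zy mulrBr mulrA -scalerAr subrK.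
  have ddE : \sum_(s1 <- S) \sum_(s2 <- S)
        ymon_dd B y (mult_inc q t) s1 s2 * aff B y (s1 + s2 + r)
      = (\sum_(s1 <- S) \sum_(s2 <- S)
          ymon_dd B y q s1 s2 * aff B y (s1 + s2 + r)) * aff B y t + D *+ 2.
    under eq_bigr do under eq_bigr do rewrite ymon_dd_inc !mulrDl.
    under eq_bigr do rewrite !big_split (sum_delta (fun=> ymon_d B y q _)) //=.
    (* The remaining delta is on the outer index [s1]; exchanging the sums makes it collapsible. *)
    rewrite !big_split /= [X in _ + X = _]exchange_big /=.
    under [X in _ + X = _]eq_bigr do
      rewrite (sum_delta (fun=> ymon_d B y q _)) //=.
    rewrite -addrA mulr2n; congr (_ + (_ + _)).
    - rewrite mulr_suml; apply: eq_bigr => s1 _.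
      rewrite mulr_suml; apply: eq_bigr => s2 _.
      by rewrite -!mulrA; congr (_ * _); exact: yC.
    - by apply: eq_bigr => s _; congr (_ * aff B y _); rewrite addrC addrA.
    - by apply: eq_bigr => s _; congr (_ * aff B y _); rewrite addrC (addrC t) addrA.
  (* Ordered pairs count [D] once for each derivative that hits [y_t]; this is the origin of the
     factor 1/2. *)
  have wD : (w / 2%:R) *: (D *+ 2) = w *: D.
    by rewrite -scaler_nat scalerA divfK.
  rewrite dE ddE ymon_inc scalerDr wD mulrA IHq mulrBl mulrDl -scalerAl.
  rewrite -[X in X + _ - _ = _]mulrA (xy t) // mulrDr mulrA.
  rewrite [X in _ = _ + X - _]addrAC [X in _ = _ + (X + _) - _]addrC.
  by rewrite opprD !addrA [X in _ = X - _]addrAC addrK.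
rewrite ymon0 mulr1 mul1r !big1 ?scaler0 ?subr0 ?addr0 // => s _.
  by rewrite big1 // => s2 _; rewrite ymon_ddE fsfun0E mulr0n mul0r.
by rewrite ymon_dE fsfun0E mulr0n mul0r.
Qed.

End CommutingFactors.
End Monomials.

(** * Coroots, vanishing of the form, and exchange relations of root vectors *)

Section RootVectors.
Variables (K : fieldType) (g : finLieType K) (H : {vspace g}).
Variables (n : nat) (alpha : n.-tuple (hdual H)) (X Y h : hdual H -> g).
Hypotheses (nz2 : 2%:R != 0 :> K) (H_cartan : cartan_subalgebra H).
Hypothesis XYh : root_vectors alpha X Y h.
Variable B : invariant_form g.
Implicit Types a b : hdual H.

(** Lets the weight [- b] of [Y b] cancel the weight [b] of [X b] when an element of [H] acts on
    their bracket. *)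
Lemma weval_oppl b k : weval (- b) k = - weval b k.
Proof. by rewrite /weval opp_lfunE. Qed.

Lemma lie_Cartan_coroot b k : positive_root alpha b -> k \in H -> [[k, h b]] = 0.
Proof.
move=> /XYh[rX rY [_ <- _ _] ] kH; have := lie_jacobi k (X b) (Y b).
rewrite (lieC (Y b) k) (rY k kH) (rX k kH) weval_oppl scaleNr opprK !lieZr.
by rewrite (lieC (Y b)) scalerN addrK.
Qed.

(** [weval] is meaningful only on [H], and [root_vectors] does not place [h b] there;
    self-normalisation of [H] does. *)
Lemma coroot_Cartan b : positive_root alpha b -> h b \in H.
Proof.
move=> rb; case: H_cartan => _ _; apply => k kH.
by rewrite lieC lie_Cartan_coroot // oppr0 mem0v.
Qed.

Lemma weval_coroot b : positive_root alpha b -> weval b (h b) = 2%:R.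
Proof.
move=> rb; have [rX _ [X0 _ hX _] ] := XYh rb.
have := rX _ (coroot_Cartan rb); rewrite hX => /eqP.
by rewrite -subr_eq0 -scalerBl scaler_eq0 (negbTE X0) orbF subr_eq0 => /eqP.
Qed.

Lemma lie_coroot_Y a b : positive_root alpha a -> positive_root alpha b ->
  [[h a, Y b]] = - weval b (h a) *: Y b.
Proof.
by move=> /coroot_Cartan ha /XYh[_ rY _]; rewrite (rY _ ha) weval_oppl.
Qed.

(** Invariance gives [B [[h a, h b]] (Y b) = B (h a) [[h b, Y b]]]: the left side is 0, the right
    side is -2 times the wanted value. *)
Lemma iform_coroot_Y a b : positive_root alpha a -> positive_root alpha b ->
  B (h a) (Y b) = 0.
Proof.
move=> ra rb; have := iform_invariant B (h a) (h b) (Y b).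
rewrite (lie_Cartan_coroot rb (coroot_Cartan ra)) iform0l lie_coroot_Y //.
rewrite weval_coroot // iformZr => /esym/eqP.
by rewrite mulf_eq0 oppr_eq0 (negbTE nz2) => /eqP.
Qed.

Lemma iform_YY b : positive_root alpha b -> B (Y b) (Y b) = 0.
Proof.
move=> rb; have := iform_invariant B (Y b) (h b) (Y b).
rewrite (lieC (Y b)) lie_coroot_Y // weval_coroot // scaleNr opprK.
rewrite -scaleNr iformZl iformZr => /eqP.
(* Invariance gave [2 B = -2 B]; the resulting 4 is written as [2 * 2] so that [nz2] applies. *)
rewrite -subr_eq0 -mulrBl opprK -natrD (natrM K 2 2) !mulf_eq0 (negbTE nz2).
by move/eqP.
Qed.

Lemma aff_Y_comm b s t :
  positive_root alpha b -> GRing.comm (aff B (Y b) s) (aff B (Y b) t).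
Proof.
by move=> rb; rewrite /GRing.comm aff_swap ?liexx ?aff0 ?addr0 //; right; exact: iform_YY.
Qed.

Lemma aff_coroot_Y a b k s : positive_root alpha a -> positive_root alpha b ->
  aff B (h a) k * aff B (Y b) s
  = aff B (Y b) s * aff B (h a) k - weval b (h a) *: aff B (Y b) (k + s).
Proof.
move=> ra rb; rewrite aff_swap; last by right; exact: iform_coroot_Y.
by rewrite lie_coroot_Y // affZ scaleNr.
Qed.

Lemma straighten_root b p r :
  positive_root alpha b -> r \notin supp_opp p ->
  aff B (X b) r * ymon B (Y b) p
  = ymon B (Y b) p * aff B (X b) r
    + \sum_(s <- finsupp p) ymon_d B (Y b) p s * aff B (h b) (r + s)
    - (weval b (h b) / 2%:R) *: \sum_(s1 <- finsupp p) \sum_(s2 <- finsupp p)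
        ymon_dd B (Y b) p s1 s2 * aff B (Y b) (s1 + s2 + r).
Proof.
move=> rb rp; apply: straighten_ymon => // [s t|s sp|k s].
- exact: aff_Y_comm.
- have [_ _ [_ <- _ _] ] := XYh rb; apply: aff_swap; left.
  rewrite addr_eq0; apply: contraNneq rp => ->.
  by apply/imfsetP; exists s.
exact: aff_coroot_Y.
Qed.

Lemma commutator_ymon_coroot a b p k :
  positive_root alpha a -> positive_root alpha b ->
  commutator (ymon B (Y b) p) (aff B (h a) k)
  = weval b (h a) *: \sum_(s <- finsupp p)
      ymon_d B (Y b) p s * aff B (Y b) (k + s).
Proof.
move=> ra rb; apply: commutator_ymon => [s t|s]; first exact: aff_Y_comm.
by rewrite /commutator aff_coroot_Y // subKr.
Qed.

End RootVectors.

(** * Assembly of the two identities over the enumerated positive roots *)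

Theorem proposition3p3 (R : realType) (g : finLieType R[i])
    (g_simple : simple_lie g)
    (H : {vspace g}) (H_cartan : cartan_subalgebra H)
    (n : nat) (alpha : n.-tuple (hdual H)) (alpha_simple : simple_system alpha)
    (m : nat) (beta : 'I_m -> hdual H)
    (beta_enum : positive_roots_enum alpha beta)
    (X Y h : hdual H -> g) (XYh : root_vectors alpha X Y h)
    (B : invariant_form g) :
  (forall (b : hdual H) (p : multiplicity) (r : int),
     positive_root alpha b -> r \notin supp_opp p ->
     aff B (X b) r * ymon B (Y b) p
     = ymon B (Y b) p * aff B (X b) r
       + \sum_(s <- finsupp p) ymon_d B (Y b) p s * aff B (h b) (r + s)
       - (weval b (h b) / 2%:R) *:
           \sum_(s1 <- finsupp p) \sum_(s2 <- finsupp p)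
             ymon_dd B (Y b) p s1 s2 * aff B (Y b) (s1 + s2 + r))
  /\
  (forall (i : 'I_m) (p : 'I_m -> multiplicity) (r : int),
     (forall j : 'I_m, (i <= j)%N -> r \notin supp_opp (p j)) ->
     aff B (X (beta i)) r
       * \prod_(j < m | (i <= j)%N) ymon B (Y (beta j)) (p j)
     = \prod_(j < m | (i <= j)%N) ymon B (Y (beta j)) (p j)
         * aff B (X (beta i)) r
       + ymon B (Y (beta i)) (p i)
         * commutator (aff B (X (beta i)) r)
             (\prod_(j < m | (i < j)%N) ymon B (Y (beta j)) (p j))
       + \sum_(s <- finsupp (p i))
           ymon_d B (Y (beta i)) (p i) s
           * \prod_(j < m | (i < j)%N) ymon B (Y (beta j)) (p j)
           * aff B (h (beta i)) (r + s)
       - (weval (beta i) (h (beta i)) / 2%:R) *: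
           \sum_(s1 <- finsupp (p i)) \sum_(s2 <- finsupp (p i))
             ymon_dd B (Y (beta i)) (p i) s1 s2
             * aff B (Y (beta i)) (s1 + s2 + r)
             * \prod_(j < m | (i < j)%N) ymon B (Y (beta j)) (p j)
       - \sum_(s <- finsupp (p i)) \sum_(t < m | (i < t)%N)
           ymon_d B (Y (beta i)) (p i) s
           * \prod_(j < m | (i < j)%N)
               (if j == t then
                  weval (beta j) (h (beta i)) *:
                    \sum_(s1 <- finsupp (p j))
                      ymon_d B (Y (beta j)) (p j) s1
                      * aff B (Y (beta j)) (r + s + s1)
                else ymon B (Y (beta j)) (p j))).
Proof.
have nz2 : 2%:R != 0 :> R[i] by rewrite Num.Theory.pnatr_eq0.
have XY := straighten_root nz2 H_cartan XYh B.
split=> [b p r rb rp | i p r rp]; first exact: XY.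
have rbeta j : positive_root alpha (beta j) by apply/(proj1 beta_enum); exists j.
set P := \prod_(j < m | (i < j)%N) ymon B (Y (beta j)) (p j).
(* The starred products are the Leibniz terms of [commutator P] with the coroot element. *)
have hP k : aff B (h (beta i)) k * P = P * aff B (h (beta i)) k
    - \sum_(t < m | (i < t)%N) \prod_(j < m | (i < j)%N)
        (if j == t then weval (beta j) (h (beta i)) *:
           \sum_(s1 <- finsupp (p j))
             ymon_d B (Y (beta j)) (p j) s1 * aff B (Y (beta j)) (k + s1)
         else ymon B (Y (beta j)) (p j)).
  apply/eqP; rewrite eq_sym subr_eq addrC -subr_eq; apply/eqP.
  rewrite -[LHS]/(commutator _ _) commutator_prodl ?index_enum_uniq //.
  apply: eq_bigr => t _; apply: eq_bigr => j _; case: eqP => // _.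
  by rewrite (commutator_ymon_coroot nz2 H_cartan XYh).
set A := ymon B (Y (beta i)) (p i); set c := weval _ _ / _.
rewrite !prodr_ord_ge -/P -/A mulrA XY ?rp // -/c mulrBl mulrDl -scalerAl.
(* The first two terms of the right side recombine into [A * X(r) * P], so the bracket of [X(r)]
   with [P] is never evaluated. *)
rewrite /commutator mulrBr !mulrA [_ + (_ - _)]addrC subrK.
rewrite [RHS]addrAC -[X in _ = X - _]addrA; congr (_ + _ - _ *: _).
  rewrite mulr_suml -sumrB; apply: eq_bigr => s _.
  by rewrite -[LHS]mulrA hP mulrBr mulrA mulr_sumr.
rewrite mulr_suml; apply: eq_bigr => s1 _.
by rewrite mulr_suml.
Qed.
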